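(* There exists an absolute constant $c>0$ such that the following holds. Let $X$ be a finite set, let $0<p\le 1$, let $t\ge 1$ be an integer, and let $\mathcal H\subseteq 2^X$. Assume that $\mathcal H$ admits a fractional cover $w:2^X\to[0,1]$ such that $\sum_{W\in 2^X}w(W)p^{|W|}\le \tfrac12$ and such that $w(W)=0$ whenever $|W|>t$. Then, with $q=cp/\log(2t)$, there exists $g:2^X\to\{0,1\}$ such that $\sum_{W\subseteq H}g(W)\ge 1$ for all $H\in\mathcal H$ and \[ \sum_{W\in 2^X}g(W)\,q^{|W|}\le \tfrac12 . \]
   Context: Logarithms are in base $2$. A fractional cover of $\mathcal H\subseteq 2^X$ is a function $w:2^X\to[0,1]$ with $\sum_{W\subseteq H}w(W)\ge 1$ for every $H\in\mathcal H$. *)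

(* Defs.v *)
From mathcomp Require Import all_boot all_order all_algebra.
From mathcomp Require Import reals exp.

Set Implicit Arguments.
Unset Strict Implicit.
Unset Printing Implicit Defensive.

Import Order.TTheory GRing.Theory Num.Theory.
Local Open Scope ring_scope.

Definition log2 (R : realType) (x : R) : R := ln x / ln 2.

Definition cover_cost (R : realType) (X : finType) (w : {set X} -> R) (p : R) : R :=
  \sum_(W : {set X}) w W * p ^+ #|W|.

Definition fractional_cover (R : realType) (X : finType)
    (H : {set {set X}}) (w : {set X} -> R) : Prop :=
  (forall W : {set X}, 0 <= w W <= 1) /\
  (forall S : {set X}, S \in H -> 1 <= \sum_(W : {set X} | W \subset S) w W).

(* Main.v *)
Require Import Defs.
From mathcomp Require Import all_boot all_order all_algebra.
From mathcomp Require Import reals exp.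
From mathcomp Require Import zify ring lra.

Set Implicit Arguments.
Unset Strict Implicit.
Unset Printing Implicit Defensive.

Import Order.TTheory GRing.Theory Num.Theory.
Local Open Scope ring_scope.

(** Colour the ground set: let [Y] be a random subset of [C * X], where [C] has a
    waiting colour [w0] and [m] active colours used cyclically, [2 ^ m] being just
    above [t], and let [hit Y] be its projection to [X].  For [S] in the hypergraph
    give [x] the load [\sum_(W | x \in W, W \subset S) w W].  If for some [S] only a
    fraction [2 ^- m.+1] of the load lies outside [hit Y], then at least half of the
    weight of the nonempty [W \subset S] is carried by sets contained in [hit Y],
    which Markov's inequality makes unlikely when [Y] has density about [p / m].

    Otherwise every member of the hypergraph contains one of few explicit sets.
    Going down through the scales [2 ^ i], one keeps an index [e] whose elements
    still missed at scale [i] lie in the given member, and whose losses among the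
    small loads are already paid for.  At scale [i] the loads above [th e i] (about
    [2 ^ i] elements) are waiting and may only use the colour [w0]; those between
    [th e i] and [th e (i + m)] have in addition used the active colours of the
    scales from [i] to the one at which they stopped waiting; smaller loads are
    settled.  One takes [e] with as few missed elements as possible.  If at most
    [2 ^ i / 2] elements are missed, one passes to scale [i - 1]; otherwise they
    form a set of the cover.  As in the proof of the Kahn-Kalai conjecture the
    expected cost of these sets is controlled by adding the missed elements to [Y]:
    from the enlarged set they are known up to [2 ^ O(2 ^ i)] possibilities. *)

(** * Order statistics of a function on a finite set *)

Section Levels.
Variables (R : realFieldType) (X : finType) (a : X -> R).

(* The [n]-th largest value of [a], and [0] if there are fewer than [n] values. *)
Definition level (n : nat) : R :=
  \big[Num.max/0]_(x | (n <= #|[set y | (a x <= a y)%R]|)%N) a x.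

Lemma level_ge0 n : 0 <= level n.
Proof. exact: bigmax_ge_id. Qed.

Lemma level_anti n n' : (n <= n')%N -> level n' <= level n.
Proof. by move=> le_n; apply: sub_bigmax => x; apply: leq_trans. Qed.

(** If [n] elements lay above the level, the least of them would take part in the maximum. *)
Lemma card_gt_level n : (0 < n)%N -> (#|[set x | (level n < a x)%R]| < n)%N.
Proof.
move=> n_gt0; rewrite ltnNge; apply/negP => le_n.
have [x0 Bx0] : exists x, x \in [set x | level n < a x].
  by apply/set0Pn; rewrite -card_gt0 (leq_trans n_gt0).
case: (arg_minP a Bx0) => x Bx min_x.
suff le_x : a x <= level n.
  by have : x \in [set y | level n < a y] by []; rewrite inE ltNge le_x.
apply: le_bigmax_cond; apply: leq_trans le_n _; apply: subset_leq_card.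
by apply/subsetP => y By; rewrite inE; apply: min_x.
Qed.

(** Positivity excludes the default value [0], so the maximum is attained. *)
Lemma card_ge_level n : 0 < level n -> (n <= #|[set x | (level n <= a x)%R]|)%N.
Proof.
pose K v := (0 < v) ==> (n <= #|[set x | (v <= a x)%R]|)%N.
suff : K (level n) by move/implyP.
apply: (big_ind K) => [|u v Ku Kv|x Px]; first by rewrite /K ltxx.
- by rewrite /Num.max; case: ifP.
- by rewrite /K Px implybT.
Qed.

Lemma level_large n : (#|X| < n)%N -> level n = 0.
Proof.
move=> gt_n; apply: big_pred0 => x; apply: negbTE; rewrite -ltnNge.
exact: leq_ltn_trans (max_card _) gt_n.
Qed.

End Levels.

(** * Random subsets of a product and their projections *)

Definition hit (C X : finType) (Y : {set C * X}) : {set X} :=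
  [set x | [exists c, (c, x) \in Y]].

Lemma hitP (C X : finType) (Y : {set C * X}) x :
  reflect (exists c, (c, x) \in Y) (x \in hit Y).
Proof. by rewrite inE; apply: existsP. Qed.

Section RandomSubset.
Variables (R : realFieldType) (U : finType) (p : R).
Hypothesis p01 : 0 < p < 1.

Definition prob (Y : {set U}) : R := \prod_u (if u \in Y then p else 1 - p).

Lemma prob_ge0 Y : 0 <= prob Y.
Proof.
have /andP[p_gt0 p_lt1] := p01.
by apply: prodr_ge0 => u _; case: ifP => _; lra.
Qed.

Lemma sum_prob_sup (F : {set U}) : \sum_(Y : {set U} | F \subset Y) prob Y = p ^+ #|F|.
Proof.
have <- : \prod_u (p + (if u \in F then 0 else 1 - p)) = p ^+ #|F|.
  rewrite -prodr_const [RHS]big_mkcond; apply: eq_bigr => u _.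
  by case: ifP => _; ring.
rewrite bigA_distr big_mkcond /=; apply: eq_bigr => Y _.
case: ifPn => [/subsetP F_sub | /subsetPn[u uF uY]].
  apply: eq_bigr => u _; case: (boolP (u \in Y)) => // uY.
  by rewrite ifN //; apply: contra uY => /F_sub.
by rewrite (bigD1 u) //= (negbTE uY) uF mul0r.
Qed.

Lemma sum_prob : \sum_(Y : {set U}) prob Y = 1.
Proof.
rewrite -[RHS](expr0 p) -(cards0 U) -sum_prob_sup.
by apply: eq_bigl => Y; rewrite sub0set.
Qed.

Lemma prob_setU (Y K : {set U}) : [disjoint K & Y] ->
  prob Y * p ^+ #|K| <= prob (Y :|: K).
Proof.
move=> dis; have /andP[p_gt0 p_lt1] := p01; rewrite -prodr_const [X in _ * X]big_mkcond -big_split /=.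
apply: ler_prod => u _; rewrite in_setU.
have [uK|uK] := boolP (u \in K); last by rewrite orbF mulr1 lexx andbT; case: ifP => _; lra.
rewrite (disjointFr dis uK) /=; apply/andP; split; nra.
Qed.

End RandomSubset.

(** Union bound over the [#|C| ^ #|W|] colourings of [W]: one of their graphs must lie in [Y]. *)
Lemma prob_hit (R : realFieldType) (C X : finType) (c0 : C) (p : R) (W : {set X}) :
  0 < p < 1 ->
  \sum_(Y : {set C * X} | W \subset hit Y) prob p Y <= (#|C|%:R * p) ^+ #|W|.
Proof.
move=> p01.
pose graph (f : {ffun X -> C}) : {set C * X} := [set (f x, x) | x in W].
have card_graph f : #|graph f| = #|W| by apply: card_imset => x y [].
pose D := pffun_on c0 (mem W) (mem C).
apply: le_trans (_ : _ <= \sum_(f in D) \sum_(Y : {set C * X} | graph f \subset Y) prob p Y) _.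
  rewrite [leRHS](exchange_big_dep predT) //= [leLHS]big_mkcond ler_sum // => Y _.
  case: ifPn => [/subsetP W_hit|_]; last first.
    by apply: sumr_ge0 => f _; apply: prob_ge0.
  pose f := [ffun x => if x \in W then odflt c0 [pick c | (c, x) \in Y] else c0].
  have f_in : (f \in D) && (graph f \subset Y).
    apply/andP; split.
      apply/pffun_onP; split=> [|c _]; last by rewrite inE.
      by apply/subsetP => x; rewrite inE ffunE; case: ifP => //; rewrite eqxx.
    apply/subsetP => _ /imsetP[x xW ->]; rewrite ffunE xW.
    case: pickP => [c //|none]; have /hitP[c Yx] := W_hit x xW.
    by have := none c; rewrite Yx.
  rewrite (bigD1 f) //= lerDl; apply: sumr_ge0 => g _; exact: prob_ge0.
rewrite (eq_bigr (fun=> p ^+ #|W|)); last by move=> f _; rewrite sum_prob_sup card_graph.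
by rewrite sumr_const card_pffun_on exprMn -[leLHS]mulr_natl natrX.
Qed.

(** * Thresholds, missed elements and admissible indices *)

Section Selector.
Variables (R : realFieldType) (X E C : finType).
Variables (lam : E -> X -> R).
Variables (m : nat) (w0 : C) (act : nat -> C).
Hypothesis lam_ge0 : forall e x, 0 <= lam e x.
Hypothesis m_gt0 : (0 < m)%N.
Hypothesis act_w0 : forall j, act j != w0.
Hypothesis act_neq : forall i j, (i < j < i + m)%N -> act j != act i.

Definition th (e : E) (k : nat) : R := level (lam e) (2 ^ k.+1).

Definition delta : R := (2 ^ m.+1)%:R^-1.

Definition mass (e : E) (k : nat) (V : {set X}) : R :=
  \sum_(x | x \notin V) Num.min (lam e x) (th e k).

(* [th e k * n] prices the [n] elements that are in [V] only because they have been
   added to the random set; removing one from [V] costs at most [th e k]. *)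
Definition budget (e : E) (V : {set X}) (n k : nat) : bool :=
  mass e k V + th e k * n%:R <= delta * mass e k set0.

Definition avoids (i : nat) (e : E) (Y : {set C * X}) (x : X) : bool :=
  ((w0, x) \notin Y) &&
  all (fun j => (lam e x <= th e j) ==> ((act j, x) \notin Y)) (iota i m).

Definition miss (i : nat) (e : E) (Y : {set C * X}) : {set X} :=
  [set x | (th e (i + m) < lam e x) && avoids i e Y x].

Definition waiting (i : nat) (e : E) : {set X} := [set x | th e i < lam e x].

(* This does not depend on the colour [act i], unlike [miss i]. *)
Definition pending (i : nat) (e : E) (Y : {set C * X}) : {set X} :=
  [set x | th e (i + m) < lam e x <= th e i & avoids i.+1 e Y x].

Definition admissible (i : nat) (Y : {set C * X}) (e : E) : bool :=
  budget e (hit Y :|: miss i e Y) #|miss i e Y| (i + m) &&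
  (#|pending i e Y| + #|miss i e Y :&: waiting i e| <= 2 ^ i)%N.

(** Missed sets are compared by inclusion; ties are broken by the number of missed waiting
    elements. *)
Definition minimal (i : nat) (Y : {set C * X}) (e : E) : bool :=
  admissible i Y e &&
  [forall e', admissible i Y e' && (miss i e' Y \subset miss i e Y) ==>
    (miss i e' Y == miss i e Y) &&
    (#|miss i e Y :&: waiting i e| <= #|miss i e' Y :&: waiting i e'|)%N].

Definition code (i : nat) (e : E) (Y : {set C * X}) : {set C * X} :=
  [set (w0, x) | x in miss i e Y :&: waiting i e] :|:
  [set (act i, x) | x in miss i e Y :\: waiting i e].

Definition box (i : nat) (e : E) (Y : {set C * X}) : {set C * X} :=
  [set (w0, x) | x in waiting i e] :|: [set (act i, x) | x in pending i e Y].

Lemma th_ge0 e k : 0 <= th e k.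
Proof. exact: level_ge0. Qed.

Lemma th_anti e k k' : (k <= k')%N -> th e k' <= th e k.
Proof. by move=> le_k; apply: level_anti; rewrite leq_exp2l. Qed.

Lemma card_waiting i e : (#|waiting i e| <= 2 ^ i.+1)%N.
Proof. by apply: ltnW; apply: card_gt_level; rewrite expn_gt0. Qed.

Lemma delta_ge0 : 0 <= delta.
Proof. by rewrite invr_ge0 ler0n. Qed.


Lemma mass_split e k (V V' : {set X}) :
  mass e k V' <= mass e k V + th e k * #|V :\: V'|%:R.
Proof.
have min_ge0 x : 0 <= Num.min (lam e x) (th e k) by rewrite le_min lam_ge0 th_ge0.
rewrite /mass (bigID (mem V)) /= addrC lerD //.
  rewrite big_mkcondl /= ler_sum // => x _.
  by case: ifP.
rewrite (eq_bigl (mem (V :\: V'))); last by move=> x; rewrite !inE.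
rewrite -sum1_card natr_sum mulr_sumr ler_sum // => x _.
by rewrite mulr1 ge_min lexx orbT.
Qed.

Lemma budget_trans e k (V V' : {set X}) n n' :
  (n' + #|V :\: V'| <= n)%N -> budget e V n k -> budget e V' n' k.
Proof.
move=> le_n; apply: le_trans.
apply: le_trans (lerD (mass_split e k V V') (lexx _)) _.
rewrite -addrA lerD2l -mulrDr ler_wpM2l ?th_ge0 // -natrD ler_nat.
by rewrite addnC.
Qed.

(* Raising the truncation height from [th k.+1] to [th k] does not affect the
   elements outside [V], costs [n] per unit of height on the left, and gains
   [delta * 2 ^ k.+1] per unit on the right. *)
Lemma budget_descend e k (V : {set X}) n :
  (forall x, x \notin V -> lam e x <= th e k.+1) ->
  n%:R <= delta * (2 ^ k.+1)%:R ->
  budget e V n k.+1 -> budget e V n k.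
Proof.
move=> small_out le_n; rewrite /budget => old.
have le_th : th e k.+1 <= th e k by apply: th_anti.
have -> : mass e k V = mass e k.+1 V.
  apply: eq_bigr => x /small_out le_x.
  by rewrite !min_l // (le_trans le_x).
suff gain : (th e k - th e k.+1) * n%:R <= delta * (mass e k set0 - mass e k.+1 set0).
  by move: old gain; rewrite mulrBl mulrBr; lra.
(* If [th e k] is [0], the two heights agree; otherwise the level is attained and at least
   [2 ^ k.+1] loads reach it. *)
have [th0|thN0] := eqVneq (th e k) 0.
  have -> : th e k.+1 = th e k.
    by apply/eqP; rewrite eq_le le_th th0 th_ge0.
  rewrite subrr mul0r mulr_ge0 ?delta_ge0 // subr_ge0 ler_sum // => x _.
  by rewrite le_min !ge_min lexx le_th orbT.
have th_gt0 : 0 < th e k by rewrite lt_def thN0 th_ge0.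
have big := card_ge_level th_gt0.
set B := [set x | _] in big.
apply: le_trans (_ : _ <= delta * ((th e k - th e k.+1) * #|B|%:R)) _.
  rewrite mulrCA ler_wpM2l ?subr_ge0 //.
  by apply: le_trans le_n _; rewrite ler_wpM2l ?delta_ge0 // ler_nat.
rewrite ler_wpM2l ?delta_ge0 // /mass -sumrB big_mkcond /=.
rewrite -sum1_card natr_sum mulr_sumr big_mkcond /= ler_sum // => x _.
rewrite !inE /= mulr1; case: ifP => [th_le|_].
  by rewrite !min_r // (le_trans le_th).
rewrite subr_ge0 le_min !ge_min lexx.
by rewrite le_th orbT.
Qed.

Lemma avoids_notin_hit i e Y x : x \notin hit Y -> avoids i e Y x.
Proof.
move=> /hitP out; apply/andP; split; first by apply/negP => Yx; case: out; exists w0.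
by apply/allP => j _; apply/implyP => _; apply/negP => Yx; case: out; exists (act j).
Qed.

Lemma miss_cover i e Y x :
  x \notin hit Y :|: miss i e Y -> lam e x <= th e (i + m).
Proof.
rewrite in_setU negb_or => /andP[outY]; rewrite inE avoids_notin_hit // andbT.
by rewrite -leNgt.
Qed.

(** The windows of scales differ at both ends, but the condition at [i + m] is vacuous for an
    unsettled element. *)
Lemma avoids_step i e Y x : th e (i + m) < lam e x ->
  avoids i e Y x = ((lam e x <= th e i) ==> ((act i, x) \notin Y)) && avoids i.+1 e Y x.
Proof.
move=> gt_x; rewrite /avoids.
set P := fun j => _.
have iotaS : iota i m.+1 = iota i m ++ [:: (i + m)%N] by rewrite -addn1 iotaD.
have -> : all P (iota i m) = P i && all P (iota i.+1 m).
  have -> : P i && all P (iota i.+1 m) = all P (iota i m.+1) by [].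
  by rewrite iotaS all_cat /= {3}/P leNgt gt_x !andbT.
by rewrite andbCA.
Qed.

Lemma miss_step i e Y : miss i e Y \subset miss i.+1 e Y.
Proof.
apply/subsetP => x; rewrite !inE => /andP[gt_x].
rewrite avoids_step // => /andP[_ ->]; rewrite andbT.
by apply: le_lt_trans gt_x; apply: th_anti; rewrite addSn.
Qed.

Lemma pending_step i e Y : pending i e Y \subset miss i.+1 e Y :\: (miss i e Y :&: waiting i e).
Proof.
apply/subsetP => x; rewrite !inE => /andP[/andP[gt_x le_x] ->].
rewrite andbT [th e i < _]ltNge le_x !andbF /=.
by apply: le_lt_trans gt_x; apply: th_anti; rewrite addSn.
Qed.

Lemma miss_waitingP i e Y x :
  (x \in miss i e Y :&: waiting i e) = (th e i < lam e x) && ((w0, x) \notin Y).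
Proof.
rewrite !inE andbC; case: (ltP (th e i)) => //= lt_x.
have -> /= : th e (i + m) < lam e x.
  by apply: le_lt_trans lt_x; apply: th_anti; rewrite leq_addr.
rewrite /avoids; case: (_ \notin Y) => //=; apply/allP => j.
rewrite mem_iota => /andP[le_ij _]; apply/implyP => le_x.
by have := lt_le_trans lt_x (le_trans le_x (th_anti e le_ij)); rewrite ltxx.
Qed.

Lemma miss_activeP i e Y x :
  (x \in miss i e Y :\: waiting i e) = (x \in pending i e Y) && ((act i, x) \notin Y).
Proof.
rewrite !inE -leNgt andbA [X in X && _ = _]andbC.
case: ltP => //= gt_x; case: (boolP (lam e x <= _)) => //= le_x.
by rewrite avoids_step // le_x /= andbC.
Qed.

(** Pending and missed waiting elements are disjoint parts of [miss i.+1 e Y], whence the count. The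
    budget first descends; then the drop in missed elements pays for removing them. *)
Lemma admissible_step i e Y :
  (2 * #|miss i.+1 e Y| <= 2 ^ i.+1)%N ->
  budget e (hit Y :|: miss i.+1 e Y) #|miss i.+1 e Y| (i.+1 + m) ->
  admissible i Y e.
Proof.
rewrite expnS leq_pmul2l // => few old; apply/andP; split; last first.
  apply: leq_trans few; rewrite -(cardsID (miss i e Y :&: waiting i e) (miss i.+1 e Y)) addnC leq_add //.
    by rewrite subset_leq_card // subsetI subxx (subset_trans (subsetIl _ _)) ?miss_step.
  exact: subset_leq_card (pending_step _ _ _).
have descended : budget e (hit Y :|: miss i.+1 e Y) #|miss i.+1 e Y| (i + m).
  apply: budget_descend old => [x /miss_cover //|].
  (* [delta * 2 ^ (i + m).+1] is exactly [2 ^ i], the bound on the missed elements. *)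
  rewrite /delta (_ : (i + m).+1 = m.+1 + i)%N ?expnD ?natrM; last by lia.
  by rewrite mulKf ?ler_nat // pnatr_eq0 expn_eq0.
apply: budget_trans descended.
rewrite -(cardsID (miss i e Y) (miss i.+1 e Y)) leq_add //; last first.
  apply/subset_leq_card/subsetP => x; rewrite !inE negb_or.
  by case/andP => /andP[/negbTE-> ->].
by rewrite subset_leq_card // subsetI subxx miss_step.
Qed.

Lemma minimal_exists i Y e : admissible i Y e ->
  exists2 e', minimal i Y e' & miss i e' Y \subset miss i e Y.
Proof.
move=> adm_e.
pose P e' := admissible i Y e' && (miss i e' Y \subset miss i e Y).
(* Lexicographic order in one number: the second count is at most [#|X|]. *)
pose key e' := (#|miss i e' Y| * #|X|.+1 + #|miss i e' Y :&: waiting i e'|)%N.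
have Pe : P e by rewrite /P adm_e subxx.
case: (arg_minnP key Pe) => e' /andP[adm_e' sub_e'] min_e'; exists e' => //.
apply/andP; split=> //; apply/forallP => f; apply/implyP => /andP[adm_f sub_f].
have {min_e'} := min_e' f; rewrite /P adm_f (subset_trans sub_f) // => /(_ isT).
have [eq_miss|neq_miss] := eqVneq (miss i f Y) (miss i e' Y).
  by rewrite /key eq_miss leq_add2l.
have lt_miss : (#|miss i f Y| < #|miss i e' Y|)%N.
  by apply: proper_card; rewrite properEneq neq_miss.
have := leq_mul lt_miss (leqnn #|X|.+1).
have : (#|miss i f Y :&: waiting i f| <= #|X|)%N := max_card _.
by rewrite mulSn /key /=; lia.
Qed.

(** * Encoding missed elements as coloured points *)

Lemma in_code i e Y c x : ((c, x) \in code i e Y) =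
  (c == w0) && (x \in miss i e Y :&: waiting i e) ||
  (c == act i) && (x \in miss i e Y :\: waiting i e).
Proof.
rewrite in_setU; congr (_ || _).
- apply/imsetP/andP => [[y y_in [-> ->]] //|[/eqP-> x_in]]; by exists x.
- apply/imsetP/andP => [[y y_in [-> ->]] //|[/eqP-> x_in]]; by exists x.
Qed.

Lemma code_snd i e Y : snd @: code i e Y = miss i e Y.
Proof.
rewrite /code imsetU -!imset_comp !(eq_imset (g := id)) ?imset_id ?setID //.
Qed.

Lemma card_code i e Y : #|code i e Y| = #|miss i e Y|.
Proof.
have inj (c : C) : injective (fun x : X => (c, x)) by move=> x y [].
rewrite /code cardsU [_ :&: [set (act i, x) | x in _]]disjoint_setI0.
  rewrite cards0 subn0 -[RHS](cardsID (waiting i e)).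
  by congr (_ + _)%N; apply: card_imset; apply: inj.
rewrite disjoints_subset; apply/subsetP => _ /imsetP[x _ ->].
rewrite inE; apply/imsetP => -[y _ [eq_c _]].
by move: (act_w0 i); rewrite -eq_c eqxx.
Qed.

Lemma code_disjoint i e Y : [disjoint code i e Y & Y].
Proof.
rewrite disjoints_subset; apply/subsetP => -[c x].
rewrite in_setC in_code miss_waitingP miss_activeP.
by case/orP => /andP[/eqP-> /andP[]].
Qed.

Lemma hit_code i e Y : hit (Y :|: code i e Y) = hit Y :|: miss i e Y.
Proof.
apply/setP => x; rewrite in_setU; apply/hitP/orP => [[c]|].
  rewrite in_setU => /orP[Yx|Kx]; first by left; apply/hitP; exists c.
  by right; rewrite -code_snd; apply/imsetP; exists (c, x).
case=> [/hitP[c Yx]|]; first by exists c; rewrite in_setU Yx.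
by rewrite -code_snd => /imsetP[[c y] Ky ->]; exists c; rewrite in_setU Ky orbT.
Qed.

(* The encoded pair [(Y, e)] is recovered from [Y :|: code i e Y] through any
   index [f] that looks at least as good there: being admissible for [Y], such an
   [f] has [miss i f Y = miss i e Y] by minimality of [e]; elements that [f] has
   pending but that are hidden by the code were waiting for [e], so they would
   also lower the number of missed waiting elements. *)
Lemma code_sub_box i e f Y : minimal i Y e ->
  miss i f (Y :|: code i e Y) = set0 ->
  budget f (hit (Y :|: code i e Y)) #|miss i e Y| (i + m) ->
  (#|pending i f (Y :|: code i e Y)| + #|miss i e Y :&: waiting i e| <= 2 ^ i)%N ->
  code i e Y \subset box i f (Y :|: code i e Y).
Proof.
move=> /andP[_ /forallP/(_ f)/implyP min_e].
set K := code i e Y; set Y' := Y :|: K; set T := miss i e Y.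
set T0 := T :&: waiting i e => miss0 budget_f few.
set T' := miss i f Y in min_e *.
have new_color c x : (c, x) \in Y' -> (c, x) \notin Y -> x \in T.
  rewrite in_setU => /orP[->//|Kx _].
  by rewrite /T -code_snd; apply/imsetP; exists (c, x).
(* Outside [T] the code adds no colour, so an element missed by [f] there would still be missed for
   [Y']. *)
have sub_T : T' \subset T.
  apply/subsetP => x x_T'; apply: contraT => x_T.
  have old c : (c, x) \notin Y -> (c, x) \notin Y'.
    by move=> notY; apply: contra x_T => /new_color; apply.
  suff : x \in miss i f Y' by rewrite miss0 inE.
  move: x_T'; rewrite !inE => /andP[-> /andP[/old nw /allP av]].
  rewrite /avoids nw; apply/allP => j /av /implyP h; apply/implyP => /h.
  exact: old.
pose hid := pending i f Y :\: pending i f Y'.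
(* Pending elements are tested only against [w0] and [act j] with [i < j < i + m]. These [act j]
   differ from [act i], so only a [w0] point of the code can hide an element. *)
have sub_hid : hid \subset T0.
  apply/subsetP => x; rewrite inE => /andP[notP' x_P]; apply: contraR notP' => x_T0.
  move: x_P; rewrite !inE => /andP[/andP[gt_x ->] /andP[nw /allP av]].
  rewrite gt_x /avoids in_setU negb_or nw in_code eqxx (negbTE x_T0) /=.
  rewrite eq_sym (negbTE (act_w0 _)) /=; apply/allP => j j_in.
  apply/implyP => le_x; rewrite in_setU negb_or (implyP (av j j_in)) //.
  rewrite in_code (negbTE (act_w0 _)) /=.
  rewrite (negbTE (act_neq _)) //; move: j_in; rewrite mem_iota addSn ltnS.
  case/andP=> -> /=; rewrite leq_eqVlt => /orP[/eqP eq_j|//].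
  by rewrite eq_j leNgt gt_x in le_x.
have sub_wait : T' :&: waiting i f \subset T0.
  apply/subsetP => x; rewrite miss_waitingP => /andP[lt_x nw].
  have : x \notin miss i f Y' :&: waiting i f by rewrite miss0 set0I inE.
  rewrite miss_waitingP lt_x /= negbK in_setU (negbTE nw) in_code eqxx /=.
  by rewrite eq_sym (negbTE (act_w0 _)) orbF.
have hid_wait : [disjoint hid & T' :&: waiting i f].
  rewrite disjoints_subset; apply/subsetP => x; rewrite !inE.
  by case/andP=> _ /andP[/andP[_ le_x] _]; rewrite [th f i < _]ltNge le_x !andbF.
(* Two disjoint parts of [T0]: this bounds the count that makes [f] admissible for [Y], and later
   forces [hid] to be empty by minimality of [e]. *)
have sub_U : hid :|: (T' :&: waiting i f) \subset T0 by rewrite subUset sub_hid.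
have card_U : #|hid :|: (T' :&: waiting i f)| = (#|hid| + #|T' :&: waiting i f|)%N.
  by rewrite cardsU [hid :&: _]disjoint_setI0 // cards0 subn0.
have le_U := subset_leq_card sub_U; rewrite card_U in le_U.
have le_P : (#|pending i f Y| <= #|pending i f Y'| + #|hid|)%N.
  rewrite -(cardsID (pending i f Y') (pending i f Y)) leq_add2r.
  by rewrite subset_leq_card // subsetIr.
have adm_f : admissible i Y f.
  apply/andP; split; last by rewrite -/T'; lia.
  apply: budget_trans budget_f; rewrite hit_code.
  rewrite -/T -(cardsID T' T) leq_add //; last first.
    apply/subset_leq_card/subsetP => x; rewrite !inE negb_or.
    by case/andP => /andP[/negbTE-> ->].
  by rewrite subset_leq_card // subsetI subxx andbT.
have {min_e} /andP[/eqP eq_T le_T0] : (T' == T) && (#|T0| <= #|T' :&: waiting i f|)%N.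
  by apply: min_e; rewrite adm_f.
have hid0 : hid = set0 by apply/eqP; rewrite -cards_eq0; lia.
have eq_T0 : T' :&: waiting i f = T0 by apply/eqP; rewrite eqEcard sub_wait.
apply/subsetP => -[c x]; rewrite in_code in_setU.
case/orP => /andP[/eqP-> x_in]; apply/orP; [left|right]; apply/imsetP; exists x => //.
  by move: x_in; rewrite -/T -/T0 -eq_T0 inE => /andP[].
have : x \in T' :\: waiting i f.
  move: x_in; rewrite -/T !in_setD eq_T => /andP[not_w x_T]; rewrite x_T andbT.
  apply: contra not_w => w_x.
  have : x \in T0 by rewrite -eq_T0 eq_T inE x_T.
  by rewrite inE => /andP[].
rewrite miss_activeP => /andP[x_P _].
apply: contraT => notP'.
have : x \in hid by rewrite inE notP'.
by rewrite hid0 inE.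
Qed.

Lemma card_box i e Y : (#|box i e Y| <= 2 ^ i.+1 + #|pending i e Y|)%N.
Proof.
apply: leq_trans (leq_card_setU _ _) _.
by rewrite leq_add ?(leq_trans (leq_imset_card _ _)) ?card_waiting.
Qed.

(** * Descent through the scales *)

Definition codes (i : nat) (Y : {set C * X}) : {set {set C * X}} :=
  [set code i e Y | e : E & minimal i Y e && (2 ^ i < 2 * #|miss i e Y|)%N].

(** At each scale a minimal index either yields a code or misses few enough elements to continue.
    Positivity is kept for the initial [e], as the code must lie in the member that [e] stands
    for. *)
Lemma codes_or_good I Y e : (2 * #|X| <= 2 ^ I)%N ->
  (exists2 i, (i < I)%N &
     exists2 K, K \in codes i Y & forall x, x \in snd @: K -> 0 < lam e x) \/
  (exists e', \sum_(x | x \notin hit Y) lam e' x <= delta * \sum_x lam e' x).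
Proof.
move=> large_I.
have [found|none] := boolP [exists i : 'I_I, [exists K in codes i Y,
    [forall x in snd @: K, 0 < lam e x]]].
  left; case/existsP: found => i /exists_inP[K K_in /forall_inP posK].
  by exists i; rewrite ?ltn_ord //; exists K.
right.
have state i : (i <= I)%N -> exists e', [/\ (2 * #|miss i e' Y| <= 2 ^ i)%N,
    forall x, x \in miss i e' Y -> 0 < lam e x
    & budget e' (hit Y :|: miss i e' Y) #|miss i e' Y| (i + m)].
  move=> le_i; rewrite -(subKn le_i); elim: (I - i)%N => [|d IHd].
    rewrite subn0; exists e; split.
    - by apply: leq_trans large_I; rewrite leq_pmul2l ?max_card.
    - move=> x; rewrite inE => /andP[lt_x _]; apply: le_lt_trans lt_x.
      exact: th_ge0.
    (* At the top scale the level exceeds the number of elements, so all truncated masses vanish. *)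
    have th0 : th e (I + m) = 0.
      apply: level_large; have := ltn_expl I (isT : 1 < 2)%N.
      have : (2 ^ I < 2 ^ (I + m).+1)%N by rewrite ltn_exp2l //; lia.
      have : (0 < 2 ^ I)%N by rewrite expn_gt0.
      lia.
    rewrite /budget /mass th0 mul0r addr0 big1 => [|x _]; last by rewrite min_r.
    by rewrite big1 ?mulr0 // => x _; rewrite min_r.
  have [le_Id|lt_dI] := leqP I d.
    by move: IHd; rewrite (eqP le_Id) (_ : I - d.+1 = 0)%N // ; lia.
  have -> : (I - d.+1 = (I - d).-1)%N by lia.
  move: IHd; have : (0 < I - d)%N by lia.
  have : (I - d <= I)%N by lia.
  case: (I - d)%N => // j lt_jI _ [e0 [few pos0 budget0]] /=.
  have [f min_f sub_f] := minimal_exists (admissible_step few budget0).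
  have sub_f' : miss j f Y \subset miss j.+1 e0 Y.
    exact: subset_trans sub_f (miss_step _ _ _).
  have pos_f x : x \in miss j f Y -> 0 < lam e x.
    by move=> /(subsetP sub_f'); apply: pos0.
  exists f; split=> //; last by case/andP: min_f => /andP[].
  rewrite leqNgt; apply: contra none => many.
  apply/existsP; exists (Ordinal lt_jI); apply/exists_inP; exists (code j f Y).
    by apply/imsetP; exists f; rewrite ?inE ?min_f.
  by apply/forall_inP => x; rewrite code_snd; apply: pos_f.
have [f [few _ budget_f]] := state 0%N (leq0n _).
have /eqP : #|miss 0 f Y| = 0%N by move: few; rewrite expn0; lia.
rewrite cards_eq0 => /eqP miss0.
exists f; move: budget_f; rewrite /budget miss0 cards0 mulr0 addr0 setU0 => budget_f.
(* With nothing missed, every load outside [hit Y] is below the truncation height. *)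
have -> : \sum_(x | x \notin hit Y) lam f x = mass f (0 + m) (hit Y).
  apply: eq_bigr => x out; rewrite min_l //.
  by apply: (miss_cover (Y := Y)); rewrite miss0 setU0.
apply: le_trans budget_f _; rewrite ler_wpM2l ?delta_ge0 //.
rewrite /mass big_mkcond ler_sum // => x _.
by rewrite inE /= ge_min lexx.
Qed.

(** * Decoding and the expected cost *)

Lemma avoids_anti i e (Y Z : {set C * X}) x : Y \subset Z -> avoids i e Z x -> avoids i e Y x.
Proof.
move=> /subsetP subYZ /andP[nw /allP av]; apply/andP; split.
  by apply: contra nw; apply: subYZ.
apply/allP => j /av /implyP h; apply/implyP => /h.
by apply: contra; apply: subYZ.
Qed.

Lemma pending_anti i e (Y Z : {set C * X}) : Y \subset Z -> pending i e Z \subset pending i e Y.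
Proof.
move=> subYZ; apply/subsetP => x; rewrite !inE => /andP[-> /=].
exact: avoids_anti.
Qed.

Lemma miss_code i e Y : miss i e (Y :|: code i e Y) = set0.
Proof.
set Z := Y :|: _; apply/setP => x; rewrite in_set0; apply/negP => x_miss.
have [w_x|w_x] := boolP (x \in waiting i e).
  have : x \in miss i e Z :&: waiting i e by rewrite in_setI x_miss.
  rewrite miss_waitingP => /andP[lt_x].
  rewrite in_setU negb_or in_code eqxx miss_waitingP lt_x /=.
  by case: (_ \in Y).
have : x \in miss i e Z :\: waiting i e by rewrite in_setD w_x.
rewrite miss_activeP => /andP[/(subsetP (pending_anti _ _ (subsetUl _ _))) x_P].
rewrite in_setU negb_or in_code eqxx miss_activeP x_P /=.
by case: (_ \in Y) => //=; rewrite orbT.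
Qed.

Definition card_w0 (K : {set C * X}) : nat := #|[set x | (w0, x) \in K]|.

Lemma card_w0_code i e Y : card_w0 (code i e Y) = #|miss i e Y :&: waiting i e|.
Proof.
apply: eq_card => x; rewrite [in LHS]inE in_code eqxx /=.
by rewrite eq_sym (negbTE (act_w0 _)) orbF.
Qed.

Lemma card_w0_le K : (card_w0 K <= #|K|)%N.
Proof.
have inj : injective (fun x : X => (w0, x)) by move=> x y [].
rewrite /card_w0 -(card_imset _ inj) subset_leq_card //.
by apply/subsetP => _ /imsetP[x + ->]; rewrite inE.
Qed.

Definition decoded (i : nat) (Z : {set C * X}) : {set {set C * X}} :=
  [set K | [exists Y, (K \in codes i Y) && (Z == Y :|: K)]].

(** Any one such code supplies an index [f]. With [n] and [w] fixed, [f] meets the hypotheses of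
    [code_sub_box] against every other code, so all lie in one box of at most [3 * 2 ^ i] points. *)
Lemma card_decoded i Z n w :
  (#|[set K in decoded i Z | (#|K| == n) && (card_w0 K == w)]| <= 2 ^ (3 * 2 ^ i))%N.
Proof.
set D := [set K in _ | _].
have [->|[K0]] := set_0Vmem D; first by rewrite cards0.
rewrite inE => /andP[]; rewrite inE => /existsP[Y0 /andP[]].
case/imsetP => f; rewrite inE => /andP[min_f _] -> /eqP eq_Z /andP[/eqP n_f /eqP w_f].
have miss_f : miss i f Z = set0 by rewrite eq_Z miss_code.
have /andP[/andP[budget_f few_f] _] := min_f.
have subDB : D \subset powerset (box i f Z).
  apply/subsetP => K; rewrite inE => /andP[]; rewrite inE => /existsP[Y /andP[]].
  case/imsetP => e; rewrite inE => /andP[min_e _] -> /eqP eq_Z' /andP[/eqP n_e /eqP w_e].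
  rewrite inE eq_Z'; apply: code_sub_box => //; rewrite -?eq_Z' //.
    by rewrite -(card_code _ _ Y) n_e -n_f eq_Z hit_code card_code.
  rewrite -card_w0_code w_e -w_f card_w0_code; apply: leq_trans few_f.
  by rewrite leq_add2r eq_Z subset_leq_card // pending_anti // subsetUl.
apply: leq_trans (subset_leq_card subDB) _.
rewrite card_powerset leq_exp2l //; apply: leq_trans (card_box _ _ _) _.
have : (#|pending i f Z| <= #|pending i f Y0|)%N.
  by rewrite eq_Z subset_leq_card // pending_anti // subsetUl.
by move: few_f; rewrite expnS; lia.
Qed.

(** For codes of size [n], [2 ^ i < 2 * n] gives at most [64 ^ n] per value of [card_w0], and there
    are [n.+1 <= 2 ^ n] such values. *)
Lemma sum_decoded (r : R) i Z : 0 <= r ->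
  \sum_(K in decoded i Z) r ^+ #|K| <=
  \sum_(n < #|X|.+1 | (2 ^ i < 2 * n)%N) (128%:R * r) ^+ n.
Proof.
move=> r_ge0; pose N := #|X|.+1.
have decP K : K \in decoded i Z -> (#|K| < N)%N /\ (2 ^ i < 2 * #|K|)%N.
  rewrite inE => /existsP[Y /andP[+ _]] => /imsetP[e]; rewrite inE => /andP[_ big_e] ->.
  by rewrite card_code ltnS max_card.
pose h (K : {set C * X}) : 'I_N * 'I_N := (inord #|K|, inord (card_w0 K)).
rewrite (partition_big h (fun nw => (2 ^ i < 2 * nw.1) && (nw.2 <= nw.1))%N) /=; last first.
  move=> K /decP[lt_K big_K]; rewrite !inordK ?big_K ?card_w0_le //.
  exact: leq_ltn_trans (card_w0_le K) lt_K.
rewrite -(pair_big_dep (fun n : 'I_N => 2 ^ i < 2 * n)%N (fun n w : 'I_N => w <= n)%N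
  (fun n w => \sum_(K in decoded i Z | h K == (n, w)) r ^+ #|K|)) /=.
apply: ler_sum => n big_n.
have inner w : \sum_(K in decoded i Z | h K == (n, w)) r ^+ #|K| <= (64%:R * r) ^+ n.
  rewrite (eq_bigl (mem [set K in decoded i Z | (#|K| == n) && (card_w0 K == w)])); last first.
    move=> K; rewrite /= [RHS]inE; apply: andb_id2l => /decP[lt_K _].
    by rewrite xpair_eqE -!val_eqE /= !inordK // (leq_ltn_trans (card_w0_le K)).
  rewrite (eq_bigr (fun=> r ^+ n)); last first.
    by move=> K /=; rewrite in_set => /and3P[_ /eqP-> _].
  rewrite sumr_const exprMn -[leLHS]mulr_natl ler_wpM2r ?exprn_ge0 // -natrX ler_nat.
  apply: leq_trans (card_decoded _ _ _ _) _.
  by rewrite -[64%N]/(2 ^ 6)%N -expnM leq_exp2l //; lia.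
apply: le_trans (ler_sum _ (fun w _ => inner w)) _.
rewrite sumr_const -[leLHS]mulr_natl (_ : 128%:R * r = 2%:R * (64%:R * r)); last by ring.
rewrite [leRHS]exprMn ler_wpM2r ?exprn_ge0 ?mulr_ge0 ?ler0n // -natrX ler_nat.
apply: leq_trans (ltn_expl n (isT : 1 < 2)%N).
rewrite -[n.+1]card_ord.
have inj : {in [pred w : 'I_N | (w <= n)%N] &, injective (fun w : 'I_N => inord w : 'I_n.+1)}.
  by move=> w w' /= le_w le_w' /(congr1 val); rewrite /= !inordK // => /val_inj.
by rewrite -(card_in_imset inj) max_card.
Qed.

(** The factor [p ^+ #|K|] pays for passing from [Y] to [Z = Y :|: K]. For fixed [K] this map is
    injective, by disjointness, so one may sum over [Z]. *)
Lemma expected_cost_level (r p : R) i : 0 < p < 1 -> 0 <= r ->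
  \sum_(Y : {set C * X}) prob p Y * \sum_(K in codes i Y) (r * p) ^+ #|K| <=
  \sum_(n < #|X|.+1 | (2 ^ i < 2 * n)%N) (128%:R * r) ^+ n.
Proof.
move=> p01 r_ge0.
have code_dis Y K : K \in codes i Y -> [disjoint K & Y].
  by case/imsetP => e _ ->; apply: code_disjoint.
apply: le_trans (_ : _ <= \sum_(K : {set C * X}) \sum_(Y | K \in codes i Y)
    prob p (Y :|: K) * r ^+ #|K|) _.
  rewrite [leRHS](exchange_big_dep predT) //=; apply: ler_sum => Y _.
  rewrite mulr_sumr; apply: ler_sum => K K_in.
  rewrite exprMn mulrCA mulrC ler_wpM2r ?exprn_ge0 //.
  exact: prob_setU (code_dis _ _ K_in).
apply: le_trans (_ : _ <= \sum_(K : {set C * X}) \sum_(Z | K \in decoded i Z)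
    prob p Z * r ^+ #|K|) _.
  apply: ler_sum => K _.
  have inj : {in [set Y | K \in codes i Y] &, injective (fun Y => Y :|: K)}.
    move=> Y Y'; rewrite !in_set => /code_dis dY /code_dis dY' eqU.
    have cut (V : {set C * X}) : [disjoint K & V] -> (V :|: K) :\: K = V.
      by move=> dV; rewrite setDUl setDv setU0; apply/setDidPl; rewrite disjoint_sym.
    by rewrite -(cut Y) // eqU cut.
  rewrite (eq_bigl (mem [set Y | K \in codes i Y])); last by move=> Y; rewrite /= in_set.
  rewrite -(big_imset (fun Z => prob p Z * r ^+ #|K|) inj) /=.
  rewrite big_mkcond [leRHS]big_mkcond; apply: ler_sum => Z _.
  case: ifP => [/imsetP[Y]|_].
    rewrite in_set => K_in ->; rewrite ifT // inE; apply/existsP; exists Y.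
    by rewrite K_in eqxx.
  by case: ifP => // _; rewrite mulr_ge0 ?prob_ge0 ?exprn_ge0.
rewrite (exchange_big_dep predT) //=.
apply: le_trans (_ : _ <= \sum_(Z : {set C * X}) prob p Z *
    \sum_(n < #|X|.+1 | (2 ^ i < 2 * n)%N) (128%:R * r) ^+ n) _.
  apply: ler_sum => Z _; rewrite -mulr_sumr ler_wpM2l ?prob_ge0 //.
  exact: sum_decoded.
by rewrite -mulr_suml sum_prob // mul1r.
Qed.

(** Size [n] occurs only at scales with [2 ^ i < 2 * n], hence at most [n] of them, leaving the
    series of [n / 32 ^ n]. *)
Lemma expected_cost (p : R) I : 0 < p < 1 ->
  \sum_(Y : {set C * X}) prob p Y *
    (\sum_(i < I) \sum_(K in codes i Y) (4096%:R^-1 * p) ^+ #|K|) <= 8%:R^-1.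
Proof.
move=> p01; have r_ge0 : 0 <= 4096%:R^-1 :> R by rewrite invr_ge0 ler0n.
under eq_bigr do rewrite mulr_sumr.
rewrite exchange_big /=.
apply: le_trans (ler_sum _ (fun (i : 'I_I) _ => expected_cost_level i p01 r_ge0)) _.
have -> : 128%:R * 4096%:R^-1 = 32%:R^-1 :> R by field.
rewrite (exchange_big_dep predT) //=.
apply: le_trans (_ : _ <= \sum_(n < #|X|.+1) n%:R * 32%:R^-1 ^+ n) _.
  apply: ler_sum => n _; rewrite sumr_const -[leLHS]mulr_natl.
  rewrite ler_wpM2r ?exprn_ge0 ?invr_ge0 ?ler0n // ler_nat.
  rewrite cardE -(size_map val) -[leqRHS](size_iota 0) uniq_leq_size //.
    by rewrite (map_inj_uniq val_inj) enum_uniq.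
  move=> _ /mapP[i + ->]; rewrite mem_enum mem_iota => big_n /=.
  rewrite -(ltn_exp2l _ _ (isT : 1 < 2)%N); apply: leq_trans (big_n) _.
  by case: (n : nat) => // k; rewrite expnS leq_pmul2l // ltn_expl.
have bound N : \sum_(n < N) n%:R * 32%:R^-1 ^+ n <= 8%:R^-1 * (1 - 2%:R^-1 ^+ N) :> R.
  elim: N => [|N IHN]; first by rewrite big_ord0 subrr mulr0.
  rewrite big_ord_recr /=; move: (\sum_(n < N) _) IHN => s IHN.
  have small : N%:R * 16%:R <= 16%:R ^+ N :> R.
    rewrite -natrX -natrM ler_nat; case: N {IHN} => // N.
    by rewrite expnS mulnC leq_pmul2l // ltn_expl.
  have -> : 32%:R^-1 = 2%:R^-1 * 16%:R^-1 :> R by field.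
  have pos2 : 0 <= 2%:R^-1 ^+ N :> R by rewrite exprn_ge0 ?invr_ge0 ?ler0n.
  have : N%:R * 16%:R^-1 ^+ N <= 16%:R^-1 :> R.
    by rewrite exprVn ler_pdivrMr ?exprn_gt0 ?ltr0n // mulrC ler_pdivlMr ?ltr0n.
  rewrite exprMn exprS => /(ler_wpM2l pos2).
  move: IHN pos2; set x := 2%:R^-1 ^+ N; set y := 16%:R^-1 ^+ N; lra.
apply: le_trans (bound _) _; rewrite ler_piMr ?invr_ge0 ?ler0n //.
by rewrite gerBl exprn_ge0 ?invr_ge0 ?ler0n.
Qed.

End Selector.

(** * Logarithm and load estimates *)

Lemma trunc_log2_le (R : realType) (t : nat) : (0 < t)%N ->
  (trunc_log 2 t).+1%:R <= log2 (2 * t%:R) :> R.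
Proof.
move=> t_gt0; have tR_gt0 : 0 < t%:R :> R by rewrite ltr0n.
have ln2_gt0 : 0 < ln (2 : R) by rewrite ln_gt0 // ltr1n.
rewrite /log2 ler_pdivlMr // [leLHS]mulr_natl -lnXn ?ltr0n //.
rewrite ler_ln ?posrE ?exprn_gt0 ?mulr_gt0 ?ltr0n //.
rewrite exprS ler_wpM2l ?ler0n // -natrX ler_nat.
exact: trunc_logP.
Qed.

Section WeightedCover.
Variables (R : realFieldType) (X : finType) (w : {set X} -> R).
Hypothesis w_ge0 : forall W, 0 <= w W.

Definition load (S : {set X}) (x : X) : R :=
  \sum_(W : {set X} | (W \subset S) && (x \in W)) w W.

Lemma load_ge0 S x : 0 <= load S x.
Proof. exact: sumr_ge0. Qed.

Lemma load_gt0 S x : 0 < load S x -> x \in S.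
Proof.
rewrite lt0r => /andP[/eqP load_neq0 _]; apply: contraPT load_neq0 => xS.
rewrite /load big_pred0 // => W; apply: contraNF xS => /andP[/subsetP]; exact.
Qed.

Lemma sum_load S (P : pred X) :
  \sum_(x | P x) load S x = \sum_(W : {set X} | W \subset S) w W * #|[set x in W | P x]|%:R.
Proof.
rewrite (exchange_big_dep (fun W : {set X} => W \subset S)) /=; last by move=> x W _ /andP[].
apply: eq_bigr => W W_S; rewrite sumr_const mulr_natr; congr (_ *+ _).
by apply: eq_card => x; rewrite inE W_S andbC.
Qed.

(** Total load is at most [t * F], while each set not inside [V] loses at least its own weight; so
    the lost weight is at most [d * t * F <= F / 2]. *)
Lemma covered_weight (t : nat) (d : R) (S V : {set X}) :
  (forall W : {set X}, (t < #|W|)%N -> w W = 0) ->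
  0 <= d -> d * t%:R <= 2^-1 ->
  \sum_(x | x \notin V) load S x <= d * \sum_x load S x ->
  \sum_(W : {set X} | (W \subset S) && (W != set0)) w W <=
    2 * \sum_(W : {set X} | (W \subset V) && (W != set0)) w W.
Proof.
move=> w_small d_ge0 d_t; rewrite !sum_load.
set F := \sum_(W | _ && _) w W; set A := \sum_(W | _ && _) w W => loss.
have F_ge0 : 0 <= F by apply: sumr_ge0.
have total : \sum_(W : {set X} | W \subset S) w W * #|[set x in W | true]|%:R <= F * t%:R.
  rewrite /F big_mkcondr mulr_suml ler_sum // => W _.
  have [->|W_neq0] := eqVneq W set0.
    by rewrite (_ : [set x in _ | _] = set0) ?cards0 ?mulr0 ?mul0r //; apply/setP => x; rewrite !inE.
  rewrite (_ : [set x in _ | _] = W); last by apply/setP => x; rewrite inE andbT.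
  have [le_t|/w_small->] := leqP #|W| t; last by rewrite !mul0r.
  by rewrite ler_wpM2l // ler_nat.
have uncovered : \sum_(W : {set X} | (W \subset S) && ~~ (W \subset V)) w W <=
    \sum_(W : {set X} | W \subset S) w W * #|[set x in W | x \notin V]|%:R.
  rewrite big_mkcondr ler_sum // => W _; case: ifP => [/subsetPn[x xW xV]|_].
    rewrite ler_peMr // ler1n card_gt0; apply/set0Pn; exists x.
    by rewrite inE xW.
  by rewrite mulr_ge0 ?ler0n.
have split_F : F <= A + \sum_(W : {set X} | (W \subset S) && ~~ (W \subset V)) w W.
  rewrite /F /A [leLHS]big_mkcond [X in _ <= X + _]big_mkcond [X in _ <= _ + X]big_mkcond.
  rewrite -big_split /= ler_sum // => W _.
  have := w_ge0 W.
  by case: (W \subset S); case: (W \subset V); case: (W != set0) => /=; lra.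
have : d * (\sum_(W : {set X} | W \subset S) w W * #|[set x in W | true]|%:R) <= F / 2.
  apply: le_trans (ler_wpM2l d_ge0 total) _.
  by rewrite mulrCA ler_wpM2l.
by move: loss uncovered; set T := \sum_(W | _) _; set U := \sum_(W | _) _; lra.
Qed.

End WeightedCover.

(** * Parameters, averaging over the random set, and the cover *)

Theorem theorem1p7 (R : realType) :
  exists c : R, 0 < c /\
    forall (X : finType) (p : R) (t : nat) (H : {set {set X}}),
      0 < p <= 1 -> (1 <= t)%N ->
      (exists w : {set X} -> R,
        [/\ fractional_cover H w,
            cover_cost w p <= 1 / 2
          & forall W : {set X}, (t < #|W|)%N -> w W = 0]) ->
      let q : R := c * p / log2 (2 * t%:R) in
      exists g : {set X} -> bool,
        (forall S : {set X}, S \in H ->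
           (1 <= \sum_(W : {set X} | W \subset S) g W)%N) /\
        cover_cost (fun W => (g W)%:R) q <= 1 / 2.
Proof.
(* [4096] comes from [expected_cost]; [8] is the [4] in [s] times the [2] in [m.+1 <= 2 * ell]. *)
exists (8 * 4096%:R)^-1; split=> [|X p t H /andP[p_gt0 p_le1] t_gt0].
  by rewrite invr_gt0 mulr_gt0 ?ltr0n.
case=> w [[w01 w_cover] w_cost w_small]; set ell := log2 _; move=> q.
have w_ge0 W : 0 <= w W by case/andP: (w01 W).
pose m := (trunc_log 2 t).+1.
have le_m : m%:R <= ell by apply: trunc_log2_le.
have ell_ge1 : 1 <= ell by apply: le_trans le_m; rewrite ler1n.
pose C : finType := option 'I_m.
pose act (j : nat) : C := Some (Ordinal (ltn_pmod j (ltn0Sn (trunc_log 2 t)))).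
have act_w0 j : act j != None by [].
have act_neq i j : (i < j < i + m)%N -> act j != act i.
  move=> /andP[lt_ij lt_j]; apply/eqP => -[/eqP].
  rewrite -/m eqn_mod_dvd 1?ltnW // => /dvdn_leq.
  by rewrite subn_gt0 lt_ij => /(_ isT); lia.
have cardC : #|C| = m.+1 by rewrite card_option card_ord.
(* Chosen so that [#|C| * s = p / 4]: each nonempty [W] gains a factor [1 / 4]. *)
pose s : R := p / (4%:R * m.+1%:R).
have mR_gt0 : 0 < m.+1%:R :> R by rewrite ltr0n.
have s_gt0 : 0 < s by rewrite divr_gt0 ?mulr_gt0 ?ltr0n.
have s_lt1 : s < 1.
  rewrite ltr_pdivrMr ?mulr_gt0 ?ltr0n // mul1r (le_lt_trans p_le1) //.
  by rewrite -natrM ltr1n mulnS.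
have s01 : 0 < s < 1 by rewrite s_gt0.
pose E : finType := {S : {set X} | S \in H}.
pose lam (e : E) := load w (val e).
have lam_ge0 e x : 0 <= lam e x by apply: load_ge0.
pose I := #|X|.*2.
have large_I : (2 * #|X| <= 2 ^ I)%N.
  by rewrite mul2n -/I; apply: ltnW (ltn_expl I (isT : 1 < 2)%N).
pose cost (Y : {set C * X}) : R :=
  \sum_(i < I) \sum_(K in codes lam m None act i Y) (4096%:R^-1 * s) ^+ #|K|.
pose wt (Y : {set C * X}) : R := \sum_(W : {set X} | (W \subset hit Y) && (W != set0)) w W.
have mean_cost : \sum_Y prob s Y * cost Y <= 8%:R^-1 by apply: expected_cost.
have mean_wt : \sum_Y prob s Y * wt Y <= 8%:R^-1.
  under eq_bigr do rewrite /wt mulr_sumr.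
  rewrite (exchange_big_dep (fun W : {set X} => W != set0)) /=; last by move=> Y W _ /andP[].
  apply: le_trans (_ : _ <= 4%:R^-1 * cover_cost w p) _; last by lra.
  rewrite mulr_sumr [leLHS]big_mkcond ler_sum // => W _.
  case: ifP => [W_neq0|_]; last by rewrite !mulr_ge0 ?invr_ge0 ?exprn_ge0 // ltW.
  rewrite -mulr_suml mulrC mulrCA ler_wpM2l //.
  rewrite (eq_bigl (fun Y => W \subset hit Y)); last by move=> Y; rewrite W_neq0 andbT.
  apply: le_trans (prob_hit None W s01) _.
  have -> : #|C|%:R * s = 4%:R^-1 * p :> R by rewrite cardC /s; field; rewrite gt_eqF.
  rewrite exprMn; apply: ler_wpM2r; first by rewrite exprn_ge0 ?ltW.
  rewrite -[leRHS]expr1; apply: ler_wiXn2l; last by rewrite card_gt0.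
    by rewrite invr_ge0 ler0n.
  by rewrite invf_le1 ?ltr0n ?ler1n.
have [Y [wt_Y cost_Y]] : exists Y, wt Y < 4%:R^-1 /\ cost Y <= 2^-1.
  have [/existsP[Y /andP[wt_Y cost_Y]]|/existsPn none] :=
    boolP [exists Y, (wt Y < 4%:R^-1) && (cost Y <= 2^-1)]; first by exists Y.
  (* Markov for both quantities at once: failure for all [Y] would give [1 <= 4 / 8 + 2 / 8]. *)
  have : \sum_(Y : {set C * X}) prob s Y <=
      4 * (\sum_Y prob s Y * wt Y) + 2 * (\sum_Y prob s Y * cost Y).
    rewrite [X in X + _]mulr_sumr [X in _ <= _ + X]mulr_sumr -big_split /=.
    apply: ler_sum => Y _.
    have wt_ge0 : 0 <= wt Y by apply: sumr_ge0.
    have cost_ge0 : 0 <= cost Y.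
      apply: sumr_ge0 => i _; apply: sumr_ge0 => K _.
      by rewrite exprn_ge0 // mulr_ge0 ?invr_ge0 ?ler0n // ltW.
    have large : 1 <= 4 * wt Y + 2 * cost Y.
      by move: (none Y); rewrite negb_and -leNgt -ltNge => /orP[]; lra.
    have := ler_wpM2l (prob_ge0 s01 Y) large; lra.
  by rewrite sum_prob; lra.
pose g (W : {set X}) := [exists i : 'I_I, W \in [set snd @: (K : {set C * X}) | K in codes lam m None act i Y]].
exists g; split=> [S SH|].
  have [[i lt_i [K K_in posK]]|[e good_e]] :=
      codes_or_good None act lam_ge0 (ltn0Sn _ : 0 < m)%N Y (Sub S SH : E) large_I.
    have sub_S : snd @: K \subset S.
      by apply/subsetP => x /posK /load_gt0; rewrite SubK.
    rewrite (bigD1 (snd @: K)) //= (_ : g _ = true) //.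
    apply/existsP; exists (Ordinal lt_i); exact: imset_f.
  have delta_t : delta R m * t%:R <= 2^-1.
    rewrite /delta expnS natrM invfM -mulrA ler_piMr ?invr_ge0 ?ler0n //.
    by rewrite mulrC ler_pdivrMr ?ltr0n ?expn_gt0 // mul1r ler_nat ltnW ?trunc_log_ltn.
  have := covered_weight w_ge0 w_small (delta_ge0 R m) delta_t good_e.
  (* The empty set lies in every [hit Y], so it was left out of [wt]; the nonempty subsets of a
     member still weigh at least [1 / 2], which contradicts [wt Y < 1 / 4]. *)
  have w_empty : w set0 <= 1 / 2.
    apply: le_trans w_cost; rewrite /cover_cost (bigD1 set0) //= cards0 mulr1 lerDl.
    by apply: sumr_ge0 => W _; rewrite mulr_ge0 ?exprn_ge0 // ltW.
  have := w_cover _ (valP e); rewrite (bigD1 set0) ?sub0set //= => total.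
  rewrite -/(wt Y); lra.
apply: le_trans (le_trans _ cost_Y) _; last by lra.
have ell_gt0 : 0 < ell by apply: lt_le_trans ell_ge1.
have q_ge0 : 0 <= q.
  rewrite /q divr_ge0 ?(ltW ell_gt0) // mulr_ge0 ?(ltW p_gt0) //.
  by rewrite invr_ge0 mulr_ge0 ?ler0n.
have le_q : q <= 4096%:R^-1 * s.
  rewrite /q /s ler_pdivrMr //.
  have le_ell : 2^-1 <= (m.+1%:R)^-1 * ell.
    rewrite mulrC ler_pdivlMr // -[m.+1]addn1 natrD; lra.
  have := ler_wpM2l (ltW p_gt0) le_ell; rewrite !invfM; move: (m.+1%:R^-1) => v; lra.
rewrite /cover_cost /cost.
(* Several codes may share a projection, so each [W] is overcounted by all codes above it. *)
apply: le_trans (_ : _ <= \sum_(W : {set X}) \sum_(i < I)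
    \sum_(K in codes lam m None act i Y | snd @: (K : {set C * X}) == W) q ^+ #|W|) _.
  apply: ler_sum => W _; rewrite /g; case: existsP => [[i /imsetP[K K_in ->]]|_]; last first.
    by rewrite mul0r; do 2!(apply: sumr_ge0 => ? _); rewrite exprn_ge0.
  rewrite mul1r (bigD1 i) //= (bigD1 K) ?K_in ?eqxx //= -addrA lerDl addr_ge0 //.
    by apply: sumr_ge0 => ? _; rewrite exprn_ge0.
  by do 2!(apply: sumr_ge0 => ? _); rewrite exprn_ge0.
rewrite exchange_big ler_sum //= => i _.
rewrite (exchange_big_dep (mem (codes lam m None act i Y))) /=; last by move=> W K _ /andP[].
apply: ler_sum => K K_in; rewrite (eq_bigl (pred1 (snd @: K))); last first.
  by move=> W; rewrite [X in X && _]K_in eq_sym.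
rewrite big_pred1_eq.
have -> : #|snd @: K| = #|K|.
  by case/imsetP: K_in => e _ ->; rewrite code_snd card_code.
by rewrite lerXn2r ?nnegrE // (le_trans q_ge0).
Qed.
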